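(* Let $f:\mathbb{R}^n\to\mathbb{R}$ be continuously differentiable and twice differentiable at every point, and suppose there is a constant $L_+>0$ such that $\nabla^2 f(x)\preceq L_+ I$ for all $x\in\mathbb{R}^n$. Suppose further that $f$ is bounded below. Let the sequence $\{x_k\}$ be generated from a starting point $x_0\in\mathbb{R}^n$ by the gradient descent iteration $x_{k+1}=x_k-\alpha\nabla f(x_k)$ with a fixed stepsize $\alpha\in(0,2/L_+)$. Then $$\lim_{k\to\infty}\|\nabla f(x_k)\|=0.$$
   Context: $\|\cdot\|$ is the Euclidean norm, and $M\preceq N$ for symmetric matrices means $N-M$ is positive semidefinite. Only an upper bound on the Hessian is assumed (no lower bound). *)

(* Defs.v *)
From mathcomp Require Import all_boot all_order all_algebra.
From mathcomp Require Import all_classical all_reals all_analysis.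

Set Implicit Arguments.
Unset Strict Implicit.
Unset Printing Implicit Defensive.

Import Order.TTheory GRing.Theory Num.Theory.
Import numFieldNormedType.Exports.

Local Open Scope classical_set_scope.
Local Open Scope ring_scope.

(* R^n is the type 'rV[R]_n of row vectors.  Its library norm `|v| is the max
   norm: it induces the usual topology, hence the usual notions of continuity
   and differentiability, but it is not the Euclidean norm. *)
Definition enorm (R : realType) (n : nat) (v : 'rV[R]_n) : R :=
  Num.sqrt (\sum_(i < n) v 0 i ^+ 2).

Definition grad (R : realType) (n : nat) (f : 'rV[R]_n -> R) (x : 'rV[R]_n) :
  'rV[R]_n := \row_(i < n) 'D_(delta_mx 0 i) f x.

(* The library Jacobian acts on row vectors from the right, so the entry (i, j)
   of the Hessian is the i-th partial derivative of the j-th partial derivative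
   of f. *)
Definition hessian (R : realType) (n : nat) (f : 'rV[R]_n -> R)
  (x : 'rV[R]_n) : 'M[R]_n := 'J (grad f) x.

Definition continuously_differentiable (R : realType) (n : nat)
  (f : 'rV[R]_n -> R) : Prop :=
  (forall x, differentiable f x) /\ continuous (grad f).

Definition twice_differentiable (R : realType) (n : nat)
  (f : 'rV[R]_n -> R) (x : 'rV[R]_n) : Prop :=
  (\forall y \near x, differentiable f y) /\ differentiable (grad f) x.

(* Only meant for symmetric matrices.  Symmetry is not part of the definition:
   the Hessian of a function is symmetric wherever it is twice differentiable
   in the above (Frechet) sense. *)
Definition psdmx (R : realType) (n : nat) (M : 'M[R]_n) : Prop :=
  forall v : 'rV[R]_n, 0 <= (v *m M *m v^T) 0 0.

Definition loewner_le (R : realType) (n : nat) (M N : 'M[R]_n) : Prop :=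
  psdmx (N - M).

(* Main.v *)
(* The upper bound on the Hessian alone gives the descent inequality
   f (x + v) <= f x + <grad f x, v> + L/2 |v|^2, by applying the mean value
   theorem twice along the segment from x to x + v.  Along a gradient step it
   reads a (1 - L a / 2) |grad f (x_k)|^2 <= f (x_k) - f (x_k.+1), and the
   constant on the left is positive for 0 < a < 2 / L.  So f (x_k) decreases;
   being bounded below it converges, the right-hand side tends to 0, and so does
   |grad f (x_k)|. *)
Require Import Defs.
From mathcomp Require Import all_boot all_order all_algebra.
From mathcomp Require Import all_classical all_reals all_analysis.
From mathcomp Require Import lra.
Import Order.TTheory GRing.Theory Num.Theory.
Import numFieldNormedType.Exports.

Local Open Scope classical_set_scope.
Local Open Scope ring_scope.

Lemma enorm_sqr (R : realType) (n : nat) (v : 'rV[R]_n) :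
  enorm v ^+ 2 = (v *m v^T) 0 0.
Proof.
rewrite sqr_sqrtr; last by apply: sumr_ge0 => i _; exact: sqr_ge0.
by rewrite mxE; apply: eq_bigr => i _; rewrite !mxE expr2.
Qed.

Lemma enormZ (R : realType) (n : nat) (a : R) (v : 'rV[R]_n) :
  enorm (a *: v) = `|a| * enorm v.
Proof.
rewrite /enorm -sqrtr_sqr -sqrtrM ?sqr_ge0// mulr_sumr; congr Num.sqrt.
by apply: eq_bigr => i _; rewrite mxE exprMn.
Qed.

(** Both derivatives are limits of the same difference quotient in [h], so a directional derivative
    of [g] passes to the line as it stands, with no chain rule. *)
Lemma is_derive_line (R : realType) (V W : normedModType R) (g : V -> W)
    (a v : V) (t : R) (l : W) :
  is_derive (a + t *: v) v g l ->
  is_derive t (1 : R) (fun s => g (a + s *: v)) l.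
Proof.
move=> [g_ex g_val].
have E : (fun h : R => h^-1 *: (((fun s => g (a + s *: v)) \o shift t) (h *: 1)
      - g (a + t *: v))) =
    (fun h : R => h^-1 *: ((g \o shift (a + t *: v)) (h *: v)
      - g (a + t *: v))).
  apply/funext => h /=; congr (_ *: (g _ - _)).
  by rewrite scaler1 scalerDl addrCA.
by split; rewrite ?/derivable ?/derive E.
Qed.

Lemma taylor2_le (R : realType) (phi dphi ddphi : R -> R) (M : R) :
  (forall t, is_derive t (1 : R) phi (dphi t)) ->
  (forall t, is_derive t (1 : R) dphi (ddphi t)) ->
  (forall t, ddphi t <= M) ->
  phi 1 <= phi 0 + dphi 0 + M / 2.
Proof.
move=> Hphi Hdphi ddphi_le.
have dphi_le t : 0 <= t -> dphi t <= dphi 0 + M * t.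
  move=> t_ge0.
  have dphi_cont : {within `[0, t], continuous dphi}.
    by apply: derivable_within_continuous => z _; exact: ex_derive.
  have [c _ Ec] := MVT_segment t_ge0 (fun z _ => Hdphi z) dphi_cont.
  have := ler_wpM2r t_ge0 (ddphi_le c); lra.
(* Subtracting the linear and quadratic terms leaves a function with derivative at most 0 on t >= 0,
   by [dphi_le], so g 1 <= g 0 = phi 0. It is built from function operations so that its derivative
   is found by instance inference. *)
pose g := phi - ((dphi 0 *: id) + ((M / 2) *: (id ^+ 2))) : R -> R.
have Hg t : is_derive t (1 : R) g (dphi t - (dphi 0 + M * t)).
  have Ht := Hphi t; apply: is_derive_eq.
  by rewrite !scaler1 /GRing.scale /= expr1; lra.
have g_cont : {within `[0, 1], continuous g}.
  by apply: derivable_within_continuous => z _; exact: ex_derive.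
have [c /[!in_itv]/= /andP[c_ge0 _] Ec] :=
  MVT_segment ler01 (fun z _ => Hg z) g_cont.
have := dphi_le c c_ge0.
have gE t : g t = phi t - (dphi 0 * t + M / 2 * t ^+ 2) by [].
move: Ec; rewrite !gE; lra.
Qed.

(** The differential is linear, so it can be expanded along the standard basis. *)
Lemma derive_gradE (R : realType) (n : nat) (f : 'rV[R]_n -> R)
    (x v : 'rV[R]_n) :
  differentiable f x -> 'D_v f x = (grad f x *m v^T) 0 0.
Proof.
move=> fx; rewrite deriveE// {1}(row_sum_delta v) linear_sum mxE.
apply: eq_bigr => i _; rewrite linearZ /= !mxE deriveE//.
by rewrite mulrC.
Qed.

Lemma is_derive_grad_dot (R : realType) (n : nat) (f : 'rV[R]_n -> R)
    (x v : 'rV[R]_n) :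
  differentiable (grad f) x ->
  is_derive x v (fun y => (grad f y *m v^T) 0 0)
    ((v *m hessian f x *m v^T) 0 0).
Proof.
move=> gx.
have dgx : derivable (grad f) x v by exact: diff_derivable.
have ci i : is_derive x v (fun y => grad f y 0 i) ((v *m hessian f x) 0 i).
  split; first by move/derivable_mxP : dgx; exact.
  by rewrite -deriveEjacobian// derive_mx// mxE.
(* As a combination of the coordinates of the gradient with constant weights, the function is
   differentiated term by term using [ci]. *)
have -> : (fun y => (grad f y *m v^T) 0 0) =
    \sum_(i < n) (v 0 i *: (fun y => grad f y 0 i)).
  apply/funext => y; rewrite mxE fct_sumE; apply: eq_bigr => i _.
  by rewrite [v^T _ _]mxE mulrC.
apply: is_derive_eq.
by rewrite mxE; apply: eq_bigr => i _; rewrite [v^T _ _]mxE mulrC.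
Qed.

(** Restricted to the line t -> x + t v, f has second derivative v H v^T, which the Loewner bound
    tested on v caps at L |v|^2. *)
Lemma descent_lemma (R : realType) (n : nat) (f : 'rV[R]_n -> R) (L : R)
    (x v : 'rV[R]_n) :
  (forall y, differentiable f y) -> (forall y, differentiable (grad f) y) ->
  (forall y, loewner_le (hessian f y) (L *: 1%:M)) ->
  f (x + v) <= f x + (grad f x *m v^T) 0 0 + L / 2 * enorm v ^+ 2.
Proof.
move=> f_diff g_diff hess_le.
have := @taylor2_le R (fun t => f (x + t *: v))
  (fun t => (grad f (x + t *: v) *m v^T) 0 0)
  (fun t => (v *m hessian f (x + t *: v) *m v^T) 0 0) (L * enorm v ^+ 2).
rewrite /= scale1r scale0r addr0 mulrAC; apply.
- move=> t; apply: is_derive_line; split; first exact: diff_derivable.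
  exact: derive_gradE.
- move=> t; apply: (@is_derive_line _ _ _ (fun y => (grad f y *m v^T) 0 0)).
  exact: is_derive_grad_dot.
- move=> t; have := hess_le (x + t *: v) v.
  rewrite mulmxBr mulmxBl -scalemxAr mulmx1 -scalemxAl mxE [X in _ + X]mxE.
  by rewrite [X in X - _]mxE subr_ge0 enorm_sqr.
Qed.

(** For v = - a grad f x, the linear term is - a |grad f x|^2 and the quadratic one L a^2 / 2 |grad
    f x|^2. *)
Lemma gradient_step_le (R : realType) (n : nat) (f : 'rV[R]_n -> R) (L a : R)
    (x : 'rV[R]_n) :
  (forall y, differentiable f y) -> (forall y, differentiable (grad f) y) ->
  (forall y, loewner_le (hessian f y) (L *: 1%:M)) ->
  a * (1 - L * a / 2) * enorm (grad f x) ^+ 2 <= f x - f (x - a *: grad f x).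
Proof.
move=> f_diff g_diff hess_le.
have := descent_lemma R n f L x (- a *: grad f x) f_diff g_diff hess_le.
rewrite enormZ exprMn real_normK ?num_real//.
rewrite linearZ /= -scalemxAr mxE -enorm_sqr scaleNr; lra.
Qed.

Theorem theorem3p3 (R : realType) (n : nat) (f : 'rV[R]_n -> R)
  (f_C1 : continuously_differentiable f)
  (f_twice : forall x : 'rV[R]_n, twice_differentiable f x)
  (Lp : R) (Lp_gt0 : 0 < Lp)
  (hess_le : forall x : 'rV[R]_n, loewner_le (hessian f x) (Lp *: 1%:M))
  (f_lb : has_lbound (range f))
  (alpha : R) (alpha_gt0 : 0 < alpha) (alpha_lt : alpha < 2 / Lp)
  (x0 : 'rV[R]_n) (x : nat -> 'rV[R]_n)
  (x_init : x 0%N = x0)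
  (x_step : forall k : nat, x k.+1 = x k - alpha *: grad f (x k)) :
  (fun k : nat => enorm (grad f (x k))) @ \oo --> (0 : R).
Proof.
have [f_diff _] := f_C1.
have g_diff y : differentiable (grad f) y by have [] := f_twice y.
pose c := alpha * (1 - Lp * alpha / 2).
have c_gt0 : 0 < c.
  rewrite mulr_gt0// subr_gt0 ltr_pdivrMr// mul1r mulrC.
  by rewrite -ltr_pdivlMr.
have step k : c * enorm (grad f (x k)) ^+ 2 <= f (x k) - f (x k.+1).
  by rewrite x_step; exact: gradient_step_le.
have fx_cvg : cvgn (f \o x).
  apply: nonincreasing_is_cvgn.
    apply/nonincreasing_seqP => k /=; rewrite -subr_ge0.
    by apply: le_trans (step k); rewrite mulr_ge0 ?sqr_ge0// ltW.
  by have [m mf] := f_lb; exists m => _ [k _ <-]; apply: mf; exists (x k).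
have diff_cvg : (fun k => f (x k) - f (x k.+1)) @ \oo --> (0 : R).
  (* The shifted sequence has the same limit, so the differences tend to 0. *)
  rewrite -(subrr (limn (f \o x))); apply: cvgB => //.
  by have := fx_cvg; rewrite -(cvg_shiftS (f \o x)).
have sqr_cvg : (fun k => enorm (grad f (x k)) ^+ 2) @ \oo --> (0 : R).
  apply: (@squeeze_cvgr _ _ _ _ (cst 0) (fun k => c^-1 * (f (x k) - f (x k.+1)))).
  - by apply: nearW => k /=; rewrite sqr_ge0 /= mulrC ler_pdivlMr// mulrC.
  - exact: cvg_cst.
  - by rewrite -(mulr0 c^-1); apply: cvgMr.
(* Norms are nonnegative, so continuity of the square root at 0 carries the limit from the squares
   to the norms. *)
have -> : (fun k => enorm (grad f (x k))) =
    Num.sqrt \o (fun k => enorm (grad f (x k)) ^+ 2).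
  by apply/funext => k /=; rewrite sqrtr_sqr ger0_norm// sqrtr_ge0.
rewrite -sqrtr0; apply: cvg_comp sqr_cvg _; exact: sqrt_continuous.
Qed.
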